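(* Let $\mathscr{A}$ be a $C^*$-algebra (not necessarily unital), let $\mathscr{X},\mathscr{Y}$ be Hilbert $\mathscr{A}$-modules, and let $t$ be a regular operator from $\mathscr{X}$ to $\mathscr{Y}$ with closed range such that $\mathrm{Ran}(t)\subseteq\mathrm{Dom}(t^* )$. Then: (i) $t^{\dagger}=(t^*t)^{\dagger}t^*=t^*(tt^* )^{\dagger}$; (ii) $(t^*t)^{\dagger}=t^{\dagger}(t^* )^{\dagger}$.
   Context: Hilbert modules are right modules with $\mathscr{A}$-valued inner product linear in the second variable. Operators are $\mathscr{A}$-linear maps $t:\mathrm{Dom}(t)\subseteq\mathscr{X}\to\mathscr{Y}$ defined on a submodule, possibly unbounded; equality of operators includes equality of domains. Composition: $\mathrm{Dom}(ts)=\{x\in\mathrm{Dom}(s): s(x)\in\mathrm{Dom}(t)\}$. A densely defined operator $t$ is adjointable if the operator $t^*$ with domain $\mathrm{Dom}(t^* )=\{y\in\mathscr{Y}:\exists z\in\mathscr{X},\ \langle t(x),y\rangle=\langle x,z\rangle\ \forall x\in\mathrm{Dom}(t)\}$, $t^*(y)=z$, is densely defined. An operator $t$ is regular if it is densely defined, closed, adjointable, and $\mathrm{Ran}(1+t^*t)$ is dense in $\mathscr{X}$. If $t$ is regular, then so are $t^*$, $t^*t$ and $tt^*$. A Moore-Penrose inverse of a regular operator $t$ from $\mathscr{X}$ to $\mathscr{Y}$ is a regular operator $s$ from $\mathscr{Y}$ to $\mathscr{X}$ with $tst=t$, $sts=s$, $(ts)^*=\overline{ts}$, $(st)^*=\overline{st}$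 (bar denotes closure). It is known that if $\mathscr{X}=\mathrm{Ker}(t)\oplus\overline{\mathrm{Ran}(t^* )}$ and $\mathscr{Y}=\mathrm{Ker}(t^* )\oplus\overline{\mathrm{Ran}(t)}$, then $t$ has a unique Moore-Penrose inverse $t^{\dagger}$, given by $\mathrm{Dom}(t^{\dagger})=\mathrm{Ran}(t)\oplus\mathrm{Ker}(t^* )$ and $t^{\dagger}(t(x_1+x_2)+x_3)=x_1$ for $x_1\in\mathrm{Dom}(t)\cap\overline{\mathrm{Ran}(t^* )}$, $x_2\in\mathrm{Ker}(t)$, $x_3\in\mathrm{Ker}(t^* )$. For a regular operator $t$ with closed range these decompositions hold for $t$, and $t$, $t^*$, $t^*t$, $tt^*$ all have closed range, so $t^{\dagger}$, $(t^* )^{\dagger}$, $(t^*t)^{\dagger}$, $(tt^* )^{\dagger}$ all exist, given by the same formula. *)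

(* Defs.v *)
From HB Require Import structures.
From mathcomp Require Import all_boot all_order all_algebra.
From mathcomp Require Import complex.
From mathcomp Require Import all_classical all_reals.
From mathcomp Require Import topology normedtype.

Set Implicit Arguments.
Unset Strict Implicit.
Unset Printing Implicit Defensive.

Import Order.TTheory GRing.Theory Num.Theory.
Import numFieldNormedType.Exports.

Local Open Scope classical_set_scope.
Local Open Scope ring_scope.

(* C*-algebras. MathComp rings are unital, so the product of a possibly
   non-unital algebra is a separate operation on a complex Banach space. *)
HB.mixin Record isCstarAlgebra (R : realType) A
    & CompleteNormedModule R[i] A := {
  amul : A -> A -> A;
  astar : A -> A;
  amulA : forall a b c, amul a (amul b c) = amul (amul a b) c;
  amulDl : forall a b c, amul (a + b) c = amul a c + amul b c;
  amulDr : forall a b c, amul a (b + c) = amul a b + amul a c;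
  amulZl : forall (l : R[i]) a b, amul (l *: a) b = l *: amul a b;
  amulZr : forall (l : R[i]) a b, amul a (l *: b) = l *: amul a b;
  astarK : forall a, astar (astar a) = a;
  astarD : forall a b, astar (a + b) = astar a + astar b;
  astarZ : forall (l : R[i]) a, astar (l *: a) = l^* *: astar a;
  astarM : forall a b, astar (amul a b) = amul (astar b) (astar a);
  normr_amul : forall a b, `|amul a b| <= `|a| * `|b|;
  normr_astar_amul : forall a, `|amul (astar a) a| = `|a| ^+ 2
}.

#[short(type="cstarAlgType")]
HB.structure Definition CstarAlgebra (R : realType) :=
  {A of isCstarAlgebra R A & CompleteNormedModule R[i] A}.

Definition cstar_pos (R : realType) (A : cstarAlgType R) (a : A) : Prop :=
  exists b : A, a = amul (astar b) b.

(* Right Hilbert modules. The norm of the underlying Banach space is the one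
   given by the inner product, ||x||^2 = ||<x, x>||; definiteness of the inner
   product is part of its being a norm. *)
HB.mixin Record isHilbertModule (R : realType) (A : cstarAlgType R) X
    & CompleteNormedModule R[i] X := {
  ract : X -> A -> X;
  inner : X -> X -> A;
  ractDl : forall x y a, ract (x + y) a = ract x a + ract y a;
  ractDr : forall x a b, ract x (a + b) = ract x a + ract x b;
  ractZl : forall (l : R[i]) x a, ract (l *: x) a = l *: ract x a;
  ractZr : forall (l : R[i]) x a, ract x (l *: a) = l *: ract x a;
  ractM : forall x a b, ract x (amul a b) = ract (ract x a) b;
  innerDr : forall x y z, inner x (y + z) = inner x y + inner x z;
  innerZr : forall (l : R[i]) x y, inner x (l *: y) = l *: inner x y;
  inner_ract : forall x y a, inner x (ract y a) = amul (inner x y) a;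
  inner_star : forall x y, astar (inner x y) = inner y x;
  inner_pos : forall x, cstar_pos (inner x x);
  normr_inner : forall x, `|inner x x| = `|x| ^+ 2
}.

#[short(type="hilbertModType")]
HB.structure Definition HilbertModule (R : realType) (A : cstarAlgType R) :=
  {X of isHilbertModule R A X & CompleteNormedModule R[i] X}.

(* A (partially defined) operator from X to Y is identified with its graph, so
   that equality of operators is equality of the domains and of the values.
   [operator t] says that the graph [t] is that of an A-linear map defined on a
   submodule of X. *)
Section Operators.
Context {R : realType} {A : cstarAlgType R}.
Implicit Types X Y Z : hilbertModType A.

Definition dom X Y (t : set (X * Y)) : set X := [set x | exists y, t (x, y)].
Definition ran X Y (t : set (X * Y)) : set Y := [set y | exists x, t (x, y)].

Definition operator X Y (t : set (X * Y)) : Prop :=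
  [/\ forall x y1 y2, t (x, y1) -> t (x, y2) -> y1 = y2,
      t (0, 0),
      forall x1 x2 y1 y2, t (x1, y1) -> t (x2, y2) -> t (x1 + x2, y1 + y2),
      forall (l : R[i]) x y, t (x, y) -> t (l *: x, l *: y) &
      forall (a : A) x y, t (x, y) -> t (ract x a, ract y a)].

Definition opid X : set (X * X) := [set p | p.2 = p.1].

Definition opadd X Y (s t : set (X * Y)) : set (X * Y) :=
  [set p | exists y1 y2, [/\ s (p.1, y1), t (p.1, y2) & p.2 = y1 + y2]].

(* [opcomp t s] is ts, i.e. s first. *)
Definition opcomp X Y Z (t : set (Y * Z)) (s : set (X * Y)) : set (X * Z) :=
  [set p | exists2 y, s (p.1, y) & t (y, p.2)].

(* A single-valued graph as soon as t is densely defined. *)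
Definition adjoint X Y (t : set (X * Y)) : set (Y * X) :=
  [set p | forall x y, t (x, y) -> inner y p.1 = inner x p.2].

Definition densely_defined X Y (t : set (X * Y)) : Prop := dense (dom t).

Definition adjointable X Y (t : set (X * Y)) : Prop :=
  densely_defined t /\ densely_defined (adjoint t).

Definition regular X Y (t : set (X * Y)) : Prop :=
  [/\ operator t, densely_defined t, closed t, adjointable t &
      dense (ran (opadd (@opid X) (opcomp (adjoint t) t)))].

(* The closure of an operator is the operator whose graph is the closure of its
   graph in the product space. *)
Definition moore_penrose X Y (t : set (X * Y)) (s : set (Y * X)) : Prop :=
  [/\ regular s,
      opcomp t (opcomp s t) = t,
      opcomp s (opcomp t s) = s,
      adjoint (opcomp t s) = closure (opcomp t s) &
      adjoint (opcomp s t) = closure (opcomp s t)].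

(* The Moore-Penrose inverse of t; the empty graph, which is not an operator,
   if there is none. *)
Definition mpinv X Y (t : set (X * Y)) : set (Y * X) :=
  xget set0 [set s | moore_penrose t s].

End Operators.

(* Main.v *)
(* Since ran t is closed and contained in dom t*, the uniform boundedness
   principle on ran t bounds |t x| by |x|; hence t is everywhere defined and
   bounded, and so is its adjoint. Write t = f, t* = g, S = f g. Uniform
   boundedness also gives |y| <= K |S y| on ran f. A symmetric S satisfies
   |(S - i m) x| >= |m| |x| for real m, because |x + i e S x|^2 <=
   |x|^2 + e^2 |S x|^2; so S - i m is onto for m <> 0, and letting m -> 0 shows
   that S maps ran f onto itself. The inverse of S on ran f, extended by 0, is the
   Moore-Penrose inverse W of S, and those of f, g and g f are g W, W f and
   g W W f. No order theory of A is used: regularity of the inverses comes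
   from the dense range of 1 + t* t or from 1 + V^2 = (V + i)(V - i). *)
Require Import Defs.
From mathcomp Require Import all_boot all_order all_algebra.
From mathcomp Require Import complex.
From mathcomp Require Import all_classical all_reals topology normedtype sequences.
From mathcomp Require Import ring lra.
Set Implicit Arguments.
Unset Strict Implicit.
Unset Printing Implicit Defensive.
Import Order.TTheory GRing.Theory Num.Theory.
Import numFieldNormedType.Exports.

Local Open Scope classical_set_scope.
Local Open Scope ring_scope.

(** * Real-valued norms, geometric Cauchy sequences, closed Lipschitz relations *)

Section RealNorm.
Context {R : realType}.

(** Norms over [R[i]] are complex numbers; passing to the real part puts all estimates in the
    ordered field [R]. *)
Definition nrm (V : normedModType R[i]) (x : V) : R := complex.Re `|x|.

Section Nrm.
Variable V : normedModType R[i].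
Implicit Types x y z : V.

Lemma nrmE x : `|x| = ((nrm x)%:C)%C.
Proof. by rewrite /nrm RRe_real ?normr_real. Qed.

Lemma nrm0 : nrm (0 : V) = 0.
Proof. by rewrite /nrm normr0. Qed.

Lemma nrm_ge0 x : 0 <= nrm x.
Proof. by rewrite -ler0c -nrmE. Qed.

Lemma nrm_eq0 x : nrm x = 0 -> x = 0.
Proof. by move=> x0; apply/normr0_eq0; rewrite nrmE x0. Qed.

Lemma nrmN x : nrm (- x) = nrm x.
Proof. by rewrite /nrm normrN. Qed.

Lemma nrmD x y : nrm (x + y) <= nrm x + nrm y.
Proof. by rewrite -lecR rmorphD/= -!nrmE ler_normD. Qed.

Lemma nrmB x y : nrm (x - y) <= nrm x + nrm y.
Proof. by rewrite -(nrmN y) nrmD. Qed.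

Lemma nrmBC x y : nrm (x - y) = nrm (y - x).
Proof. by rewrite -nrmN opprB. Qed.

Lemma nrm_le x y : nrm x <= nrm y + nrm (x - y).
Proof. by rewrite -{1}(subrK y x) addrC nrmD. Qed.

Lemma nrm_tri z x y : nrm (x - y) <= nrm (x - z) + nrm (z - y).
Proof. by rewrite -(subrKA z) nrmD. Qed.

Lemma nrmZ (l : R[i]) x : nrm (l *: x) = complex.Re `|l| * nrm x.
Proof.
apply: complexI; rewrite rmorphM/= -!nrmE normrZ nrmE.
by rewrite RRe_real ?normr_real.
Qed.

Lemma nrmZr (r : R) x : nrm ((r%:C)%C *: x) = `|r| * nrm x.
Proof. by rewrite nrmZ normc_def/= expr0n/= addr0 sqrtr_sqr. Qed.

Lemma nrmZi x : nrm ('i%R *: x) = nrm x.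
Proof. by rewrite nrmZ normCi mul1r. Qed.

Lemma nbhs_nrmP x (B : set V) :
  nbhs x B <-> exists2 e : R, 0 < e & forall y, nrm (x - y) < e -> B y.
Proof.
split=> [/nbhs_normP[e /= e0 eB]|[e e0 eB]].
  have eE := RRe_real (gtr0_real e0).
  exists (complex.Re e); first by rewrite -ltcR eE.
  by move=> y xy; apply: eB; rewrite /ball_/= nrmE -eE ltcR.
apply/nbhs_normP; exists (e%:C)%C; first by rewrite /= ltcR.
by move=> y; rewrite /ball_/= nrmE ltcR; exact: eB.
Qed.

Lemma closureP_nrm (F : set V) x :
  closure F x <-> forall e : R, 0 < e -> exists2 y, F y & nrm (x - y) < e.
Proof.
split=> [Fx e e0|Fx B /nbhs_nrmP[e e0 eB]].
  have /Fx[y [Fy xy]] : nbhs x [set y | nrm (x - y) < e].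
    by apply/nbhs_nrmP; exists e.
  by exists y.
by have [y Fy /eB By] := Fx _ e0; exists y.
Qed.

Lemma denseP_nrm (F : set V) :
  dense F <-> forall x (e : R), 0 < e -> exists2 y, F y & nrm (x - y) < e.
Proof.
split=> [dF x|dF O [x Ox] oO].
  apply/closureP_nrm => B; rewrite nbhsE => -[O [oO Ox] OB].
  by have [y [Oy Fy]] := dF O (ex_intro _ x Ox) oO; exists y; split=> //; exact: OB.
have /nbhs_nrmP[e e0 eO] : nbhs x O by exact: open_nbhs_nbhs.
by have [y Fy /eO Oy] := dF x e e0; exists y.
Qed.

End Nrm.

Lemma closureP_nrm2 (V W : normedModType R[i]) (G : set (V * W)) x y :
  closure G (x, y) <-> forall e : R, 0 < e ->
    exists x' y', [/\ G (x', y'), nrm (x - x') < e & nrm (y - y') < e].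
Proof.
split=> [Gxy e e0|Gxy B [[P Q]] /= [/nbhs_nrmP[e e0 eP] /nbhs_nrmP[d d0 dQ]] PQB].
  have /Gxy[[x' y'] [Gx' [/= xe ye]]] :
      nbhs (x, y) [set p | nrm (x - p.1) < e /\ nrm (y - p.2) < e].
    exists ([set x' | nrm (x - x') < e], [set y' | nrm (y - y') < e]) => /=.
      by split; apply/nbhs_nrmP; exists e.
    by case=> ? ? [].
  by exists x', y'.
have [|x' [y' [Gx' xe ye]]] := Gxy (Num.min e d); first by rewrite lt_min e0.
move: xe ye; rewrite !lt_min => /andP[/eP Px' _] /andP[_ /dQ Qy'].
by exists (x', y'); split=> //; exact: PQB.
Qed.

Lemma expr_small (r c e : R) : 0 <= r < 1 -> 0 < e -> exists n, c * r ^+ n < e.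
Proof.
move=> /andP[r0 r1] e0.
have := @cvg_expr _ r; rewrite ger0_norm// => /(_ r1).
move=> /cvgrPdist_lt /(_ (e / (`|c| + 1))).
have c1 : 0 < `|c| + 1 by rewrite ltr_wpDl.
move=> /(_ (divr_gt0 e0 c1)) [n _ /(_ n (leqnn n))] /=.
rewrite sub0r normrN ger0_norm ?exprn_ge0// ltr_pdivlMr// mulrC => rn.
exists n; apply: le_lt_trans rn; rewrite ler_wpM2r ?exprn_ge0//.
by rewrite (le_trans (ler_norm c))// lerDl.
Qed.

(** The tail bound satisfies [b n = c * r ^+ n + b n.+1], so induction on [k] bounds
    [u (n + k) - u n] by [b n] uniformly in [k]; this gives both the limit and its explicit
    error. *)
Lemma cvg_geometric_steps (V : completeNormedModType R[i]) (u : nat -> V)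
    (c r : R) : 0 <= c -> 0 <= r < 1 ->
  (forall n, nrm (u n.+1 - u n) <= c * r ^+ n) ->
  exists l, forall n, nrm (l - u n) <= c * r ^+ n / (1 - r).
Proof.
move=> c0 r01 ur; have /andP[r0 r1] := r01.
have r1' : 0 < 1 - r by rewrite subr_gt0.
pose b n := c * r ^+ n / (1 - r).
have bS n : b n = c * r ^+ n + b n.+1.
  by rewrite /b exprS; field; rewrite lt0r_neq0.
have b0 n : 0 <= b n by rewrite /b !mulr_ge0 ?exprn_ge0// invr_ge0 ltW.
have uB n k : nrm (u (n + k)%N - u n) <= b n.
  elim: k n => [|k IH] n; first by rewrite addn0 subrr nrm0.
  rewrite addnS -addSn bS (le_trans (nrm_tri (u n.+1) _ _))//.
  by rewrite addrC lerD.
have small (e : R) : 0 < e -> exists n, b n < e.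
  move=> e0; have [n ne] := @expr_small r (c / (1 - r)) e r01 e0.
  by exists n; rewrite /b mulrAC.
have /cauchy_cvgP/cvg_ex[l /= ul] : cauchy (u @ \oo).
  apply: cauchy_exP => e e0.
  have eE := RRe_real (gtr0_real e0).
  have /small[n ne] : 0 < complex.Re e by rewrite -ltcR eE.
  exists (u n); exists n => // m /= nm.
  rewrite -ball_normE /ball_/= nrmE -eE ltcR nrmBC.
  by rewrite (le_lt_trans _ ne)// -(subnKC nm).
exists l => n; apply/ler_addgt0Pr => e e0.
have /ul[m _ /(_ (n + m)%N (leq_addl _ _)) /=] : nbhs l [set y | nrm (l - y) < e].
  by apply/nbhs_nrmP; exists e.
move=> lu; rewrite (le_trans (nrm_tri (u (n + m)%N) _ _))//.
by rewrite addrC lerD// ltW.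
Qed.

(** The values over points [2^-n]-close to [x] form a geometric Cauchy sequence, whose limit is a
    value at [x]. This turns dense domains, and dense ranges via inverse graphs, into full ones. *)
Lemma closed_bounded_dom (V : normedModType R[i]) (W : completeNormedModType R[i])
    (G : set (V * W)) (K : R) (x : V) :
  closed G ->
  (forall a b a' b', G (a, b) -> G (a', b') -> nrm (b - b') <= K * nrm (a - a')) ->
  (forall e : R, 0 < e -> exists a b, G (a, b) /\ nrm (x - a) < e) ->
  exists y, G (x, y).
Proof.
move=> cG GK Gx.
wlog K0 : K GK / 0 < K.
  move=> /(_ (`|K| + 1)); apply; last by rewrite ltr_wpDl.
  move=> a b a' b' /GK/[apply] /le_trans; apply.
  by rewrite ler_wpM2r ?nrm_ge0// (le_trans (ler_norm K))// lerDl.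
have h01 : 0 <= (2^-1 : R) < 1 by lra.
have /choice[p pP] n : exists p : V * W, G p /\ nrm (x - p.1) < (2^-1) ^+ n.
  have [|a [b [Gab xa]]] := Gx ((2^-1) ^+ n); first by rewrite exprn_gt0 ?invr_gt0.
  by exists (a, b).
(* The factor 2 covers the distance of consecutive points, at most [2^-n + 2^-(n+1)]. *)
have [|//|n|l lP] := @cvg_geometric_steps W (snd \o p) (2 * K) 2^-1.
- by rewrite mulr_ge0// ltW.
- have [[Gn xn] [Gm xm]] := (pP n, pP n.+1).
  rewrite /= (le_trans (GK (p n.+1).1 _ (p n).1 _ _ _)) -?surjective_pairing ?Gn ?Gm//.
  rewrite [2 * K]mulrC -mulrA ler_wpM2l ?(ltW K0)//.
  rewrite (le_trans (nrm_tri x _ _))// nrmBC.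
  have : (2^-1 : R) ^+ n.+1 <= 2^-1 ^+ n.
    by rewrite exprS ler_piMl ?exprn_ge0 ?invr_ge0//; lra.
  by lra.
exists l; apply/cG/closureP_nrm2 => e e0.
have [n nE] := @expr_small 2^-1 (2 * K / (1 - 2^-1) + 1) e h01 e0.
have [Gn xn] := pP n; exists (p n).1, (p n).2.
have h0 : 0 <= (2^-1 : R) ^+ n by rewrite exprn_ge0 ?invr_ge0.
have K1 : 0 <= 2 * K / (1 - 2^-1) * 2^-1 ^+ n.
  by rewrite mulr_ge0// divr_ge0 ?mulr_ge0//; lra.
split; first by rewrite -surjective_pairing.
  by move: nE xn K1; rewrite mulrDl mul1r; lra.
have := lP n; rewrite /= mulrAC; move: nE; rewrite mulrDl mul1r.
have h1 : 0 < (2^-1 : R) ^+ n by rewrite exprn_gt0 ?invr_gt0.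
by lra.
Qed.

End RealNorm.

(** * Inner product estimates and the uniform boundedness principle *)

Section HilbertModuleTheory.
Context {R : realType} {A : cstarAlgType R}.
Implicit Types X Y Z : hilbertModType A.

Lemma innerDl X (x y z : X) : inner (x + y) z = inner x z + inner y z.
Proof. by rewrite -inner_star innerDr astarD !inner_star. Qed.

Lemma innerZl X (l : R[i]) (x y : X) : inner (l *: x) y = l^* *: inner x y.
Proof. by rewrite -inner_star innerZr astarZ inner_star. Qed.

Lemma inner0r X (x : X) : inner x 0 = 0.
Proof. by rewrite -(scale0r x) innerZr scale0r. Qed.

Lemma inner0l X (x : X) : inner 0 x = 0.
Proof. by rewrite -(scale0r x) innerZl rmorph0 scale0r. Qed.

Lemma innerNr X (x y : X) : inner x (- y) = - inner x y.
Proof. by rewrite -scaleN1r innerZr scaleN1r. Qed.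

Lemma innerNl X (x y : X) : inner (- x) y = - inner x y.
Proof. by rewrite -scaleN1r innerZl rmorphN1 scaleN1r. Qed.

Lemma innerBr X (x y z : X) : inner x (y - z) = inner x y - inner x z.
Proof. by rewrite innerDr innerNr. Qed.

Lemma innerBl X (x y z : X) : inner (x - y) z = inner x z - inner y z.
Proof. by rewrite innerDl innerNl. Qed.

Lemma inner_ractl X (x y : X) (a : A) :
  inner (ract x a) y = amul (astar a) (inner x y).
Proof. by rewrite -inner_star inner_ract astarM inner_star. Qed.

Lemma nrm_inner X (x : X) : nrm (inner x x) = nrm x ^+ 2.
Proof.
by apply: complexI; rewrite -nrmE normr_inner nrmE -rmorphXn.
Qed.

Lemma inner_eq0 X (x : X) : inner x x = 0 -> x = 0.
Proof.
move=> xx; apply: nrm_eq0; apply/eqP.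
by rewrite -sqrf_eq0 -nrm_inner xx nrm0.
Qed.

Lemma inner_ext X (y z : X) : (forall x, inner x y = inner x z) -> y = z.
Proof.
move=> yz; apply/subr0_eq/inner_eq0.
by rewrite innerBr yz subrr.
Qed.

(* The positivity needed for the sharp inequality is bypassed: polarization and
   the triangle inequality give it up to a constant, which is all we use. *)
Lemma nrm_inner_le X (x y : X) : nrm (inner x y) <= 8 * (nrm x * nrm y).
Proof.
have re (u v : X) :
    nrm (inner u v + inner v u) <= 2 * (nrm u + nrm v) ^+ 2.
  have -> : inner u v + inner v u = inner (u + v) (u + v) - inner u u - inner v v.
    rewrite innerDl !innerDr !addrA [RHS]addrAC addrK.
    by rewrite -[_ + inner u v + _]addrA [inner u u + _]addrC addrK.
  rewrite (le_trans (nrmB _ _))//.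
  have := nrmB (inner (u + v) (u + v)) (inner u u).
  rewrite !nrm_inner.
  have := nrmD u v; have := nrm_ge0 u; have := nrm_ge0 v; have := nrm_ge0 (u + v).
  by nra.
have crude (u v : X) : nrm (inner u v) <= 2 * (nrm u + nrm v) ^+ 2.
  have E : ((2 : R)%:C)%C *: inner u v = (inner u v + inner v u)
      - 'i *: (inner u ('i *: v) + inner ('i *: v) u).
    rewrite innerZr innerZl conjCi scalerDr !scalerA -expr2 sqrCi.
    rewrite mulrN -expr2 sqrCi opprK scaleN1r scale1r opprD opprK addrACA subrr addr0.
    by rewrite -[(2%:C)%C]/((1 + 1)%:C%C) rmorphD scalerDl !scale1r.
  have := nrmZr 2 (inner u v); rewrite E ger0_norm//.
  have := nrmB (inner u v + inner v u) ('i *: (inner u ('i *: v) + inner ('i *: v) u)).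
  have := re u v; have := re u ('i *: v); rewrite !nrmZi.
  by lra.
have [x0|x0] := eqVneq (nrm x) 0; first by rewrite (nrm_eq0 x0) inner0l !nrm0; lra.
have [y0|y0] := eqVneq (nrm y) 0; first by rewrite (nrm_eq0 y0) inner0r !nrm0; lra.
have p : 0 < nrm x * nrm y by rewrite mulr_gt0 ?lt0r ?x0 ?y0 ?nrm_ge0.
(* Rescaling gives both vectors the norm [p = |x| |y|]; the crude bound becomes [2 (2p)^2 = p * 8p],
   and one factor [p] cancels. *)
have := crude ((nrm y)%:C%C *: x) ((nrm x)%:C%C *: y).
rewrite innerZr innerZl scalerA -[((nrm y)%:C%C)^*]/(conjc (nrm y)%:C%C) conjc_real.
rewrite -rmorphM/= !nrmZr !ger0_norm ?nrm_ge0 ?(ltW p)// [nrm y * nrm x]mulrC.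
by rewrite (_ : 2 * _ ^+ 2 = nrm x * nrm y * (8 * (nrm x * nrm y))) ?ler_pM2l//; ring.
Qed.

Definition submodule X (F : set X) :=
  [/\ F 0, forall x y, F x -> F y -> F (x + y) & forall (l : R[i]) x, F x -> F (l *: x)].

Lemma submoduleB X (F : set X) x y : submodule F -> F x -> F y -> F (x - y).
Proof. by move=> [_ FD FZ] Fx Fy; apply: FD => //; rewrite -scaleN1r; exact: FZ. Qed.

Lemma submoduleT X : submodule [set: X].
Proof. by []. Qed.

(* Gliding hump: if [u n] is a sequence in [U] with huge norms, summing up
   [+- 17^-n (u n / |u n|)] with suitable signs gives a point [l] of [F] for which
   [inner (u n) l] is unbounded; 17 beats the constant of [nrm_inner_le]. *)
Lemma uniform_boundedness X (F U : set X) :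
  closed F -> submodule F -> U `<=` F ->
  (forall y, F y -> exists C : R, forall u, U u -> nrm (inner u y) <= C) ->
  exists K : R, forall u, U u -> nrm u <= K.
Proof.
move=> cF smF UF bU; have [F0 FD FZ] := smF.
apply/not_existsP => nK.
have {}nK K : exists u, U u /\ K < nrm u.
  apply/not_existsP => nu; apply: (nK K) => u Uu.
  by rewrite leNgt; apply/negP => Ku; apply: (nu u).
pose r : R := 17^-1.
have r0 n : 0 < r ^+ n by rewrite exprn_gt0// invr_gt0.
have /choice[u uP] n : exists u, U u /\ 2 * n%:R / r ^+ n < nrm u by exact: nK.
have u0 n : 0 < nrm (u n).
  by apply: le_lt_trans (uP n).2; rewrite !mulr_ge0// invr_ge0 ltW.
pose w n := ((r ^+ n / nrm (u n))%:C)%C *: u n.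
have wn n : nrm (w n) = r ^+ n.
  rewrite nrmZr ger0_norm; last by rewrite divr_ge0// ltW.
  by rewrite divfK// gt_eqF.
have uw n : nrm (inner (u n) (w n)) = r ^+ n * nrm (u n).
  rewrite innerZr nrmZr ger0_norm ?divr_ge0 ?(ltW (u0 n)) ?(ltW (r0 n))//.
  by rewrite nrm_inner expr2 mulrA divfK// gt_eqF.
pose y := fix y n := if n is n.+1 then
  if nrm (inner (u n) (w n)) <= nrm (inner (u n) (y n + w n)) then y n + w n
  else y n - w n else 0.
have yF n : F (y n).
  elim: n => [//|n IH] /=; have Fw : F (w n) by apply/FZ/UF; exact: (uP n).1.
  by case: ifP => _; [exact: FD|exact: submoduleB].
have yS n : nrm (y n.+1 - y n) <= 1 * r ^+ n.
  by rewrite mul1r /=; case: ifP => _; rewrite addrC addKr ?nrmN wn.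
have uy n : r ^+ n * nrm (u n) <= nrm (inner (u n) (y n.+1)).
  rewrite /= -uw; case: ifPn => //; rewrite -ltNge => lt.
  (* The two signs cannot both fail: [2 <u, w>] is the difference of the pairings of [u] with
     [y + w] and [y - w]. *)
  have : nrm (((2 : R)%:C)%C *: inner (u n) (w n)) <=
      nrm (inner (u n) (y n + w n)) + nrm (inner (u n) (y n - w n)).
    apply: le_trans (nrmB _ _); rewrite -innerBr opprB addrC.
    rewrite -addrA addKr innerDr.
    by rewrite -[X in nrm (X *: _)]/((1 + 1)%:C%C) rmorphD scalerDl !scale1r.
  by rewrite nrmZr ger0_norm//; lra.
have [|l lP] := @cvg_geometric_steps _ X y 1 r ler01 _ yS; first by rewrite /r; lra.
have Fl : F l.
  apply/cF/closureP_nrm => e e0.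
  have [|n ne] := @expr_small R r (1 / (1 - r)) e _ e0; first by rewrite /r; lra.
  by exists (y n) => //; rewrite (le_lt_trans (lP n))// mulrAC.
have [C CP] := bU l Fl.
pose n := Num.bound `|C|; have Cn : C < n%:R.
  by apply: le_lt_trans (ler_norm C) _; exact: archi_boundP.
have [Un un] := uP n.
suff : n%:R < nrm (inner (u n) l) by rewrite ltNge (le_trans (CP _ Un))// ltW.
have : nrm (inner (u n) (y n.+1)) <= nrm (inner (u n) l) + nrm (inner (u n) (l - y n.+1)).
  by rewrite innerBr nrmBC nrm_le.
have := nrm_inner_le (u n) (l - y n.+1).
(* The tail is [r ^+ n.+1 / (1 - r) = r ^+ n / 16]; times the constant 8 it costs half of
   [r ^+ n * |u n|], and the other half exceeds [n] by the choice of [u n]. *)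
have : nrm (u n) * nrm (l - y n.+1) <= nrm (u n) * (r ^+ n / 16).
  rewrite ler_wpM2l ?nrm_ge0// (le_trans (lP _))// exprS mul1r.
  by rewrite [r * _]mulrC -mulrA (_ : r / (1 - r) = 16^-1)// /r; field.
move: un; rewrite ltr_pdivrMr//; have := uy n; nra.
Qed.

End HilbertModuleTheory.

(** * Everywhere defined adjointable maps *)

Section Adjoints.
Context {R : realType} {A : cstarAlgType R}.
Implicit Types X Y Z : hilbertModType A.

(** Uniform boundedness applied to the values over the unit ball, then rescaling. Stated for
    relations so as to cover a total map, a partially defined operator and the inverse of a map on a
    closed range. *)
Lemma bounded_relation X Y (F : set Y) (G : set (X * Y)) :
  closed F -> submodule F ->
  (forall (l : R[i]) x y, G (x, y) -> G (l *: x, l *: y)) ->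
  (forall x y, G (x, y) -> F y) ->
  (forall z, F z -> exists C : R, forall x y, G (x, y) ->
    nrm (inner y z) <= C * nrm x) ->
  exists2 K : R, 0 < K & forall x y, G (x, y) -> nrm y <= K * nrm x.
Proof.
move=> cF sF GZ GF bG.
have [|z Fz|K KP] := @uniform_boundedness _ _ _ F
    [set y | exists2 x, G (x, y) & nrm x <= 1] cF sF.
- by move=> y [x /GF].
- have [C CP] := bG z Fz; exists `|C| => y [x Gxy x1].
  rewrite (le_trans (CP _ _ Gxy))// (le_trans (ler_norm _))// normrM.
  by rewrite ler_piMr// ger0_norm ?nrm_ge0.
exists (`|K| + 1) => [|x y Gxy]; first by rewrite ltr_wpDl.
have [x0|x0] := eqVneq (nrm x) 0.
  (* [G] may be multivalued at 0: a nonzero [y] there could be rescaled to norm [|K| + 1], above the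
     bound. *)
  rewrite x0 mulr0 leNgt; apply/negP => y0.
  have /KP : exists2 x', G (x', ((`|K| + 1) / nrm y)%:C%C *: y) & nrm x' <= 1.
    by exists (((`|K| + 1) / nrm y)%:C%C *: x); [exact: GZ|rewrite nrmZr x0 mulr0].
  rewrite nrmZr ger0_norm ?divr_ge0 ?nrm_ge0 ?addr_ge0// divfK ?gt_eqF//.
  by have := ler_norm K; lra.
have {}x0 : 0 < nrm x by rewrite lt0r x0 nrm_ge0.
have /KP : exists2 x', G (x', ((nrm x)^-1)%:C%C *: y) & nrm x' <= 1.
  exists (((nrm x)^-1)%:C%C *: x); first exact: GZ.
  by rewrite nrmZr ger0_norm ?invr_ge0 ?nrm_ge0// mulVf// gt_eqF.
rewrite nrmZr ger0_norm ?invr_ge0 ?nrm_ge0// ler_pdivrMl// mulrC => /le_trans; apply.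
by rewrite ler_wpM2r ?nrm_ge0// (le_trans (ler_norm K))// lerDl.
Qed.

(** This identity forces [A]-linearity and boundedness of both maps, so it is the only datum carried
    along. *)
Definition adj X Y (f : X -> Y) (g : Y -> X) :=
  forall x y, inner (f x) y = inner x (g y).

Lemma adj_sym X Y (f : X -> Y) (g : Y -> X) : adj f g -> adj g f.
Proof. by move=> fg y x; rewrite -inner_star -fg inner_star. Qed.

Lemma adj_comp X Y Z (f : X -> Y) g (f' : Y -> Z) g' :
  adj f g -> adj f' g' -> adj (f' \o f) (g \o g').
Proof. by move=> fg fg' x z /=; rewrite fg' fg. Qed.

Lemma adj_comp_sym X Y (f : X -> Y) (g : Y -> X) : adj f g -> adj (f \o g) (f \o g).
Proof. by move=> fg; exact: adj_comp (adj_sym fg) fg. Qed.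

Lemma inner_extl X (y z : X) : (forall x, inner y x = inner z x) -> y = z.
Proof. by move=> yz; apply: inner_ext => x; rewrite -inner_star yz inner_star. Qed.

Section Adj.
Variables (X Y : hilbertModType A) (f : X -> Y) (g : Y -> X).
Hypothesis fg : adj f g.

Lemma adjD x y : f (x + y) = f x + f y.
Proof. by apply: inner_extl => z; rewrite innerDl !fg innerDl. Qed.

Lemma adjZ (l : R[i]) x : f (l *: x) = l *: f x.
Proof. by apply: inner_extl => z; rewrite innerZl !fg innerZl. Qed.

Lemma adjN x : f (- x) = - f x.
Proof. by rewrite -scaleN1r adjZ scaleN1r. Qed.

Lemma adjB x y : f (x - y) = f x - f y.
Proof. by rewrite adjD adjN. Qed.

Lemma adj0 : f 0 = 0.
Proof. by rewrite -(scale0r 0) adjZ scale0r. Qed.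

Lemma adj_ract (a : A) x : f (ract x a) = ract (f x) a.
Proof. by apply: inner_extl => z; rewrite inner_ractl !fg inner_ractl. Qed.

(** Hellinger-Toeplitz: [<f x, z> = <x, g z>] is bounded in [x] for each [z]. *)
Lemma adj_bounded : exists2 K : R, 0 < K & forall x, nrm (f x) <= K * nrm x.
Proof.
have [l x y /= ->|//|z _|K K0 KP] :=
    @bounded_relation X Y setT [set p | p.2 = f p.1] closedT (submoduleT _).
- by rewrite adjZ.
- exists (8 * nrm (g z)) => x _ /= ->; rewrite fg.
  by rewrite (le_trans (nrm_inner_le _ _))// mulrA mulrAC.
by exists K => // x; exact: KP.
Qed.

Lemma adj_submodule_range : submodule (range f).
Proof.
split=> [|_ _ [x _ <-] [y _ <-]|l _ [x _ <-]]; first by exists 0; rewrite ?adj0.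
- by exists (x + y); rewrite ?adjD.
- by exists (l *: x); rewrite ?adjZ.
Qed.

(** The inverse graph of [f] on [F] is closed since [f] is bounded, and Lipschitz by the lower
    bound; so a limit of values of [f] on [F] is a value. *)
Lemma adj_surjective_of_lower (F : set X) (K : R) z : closed F -> submodule F ->
  (forall y, F y -> nrm y <= K * nrm (f y)) ->
  (forall e : R, 0 < e -> exists2 y, F y & nrm (z - f y) < e) ->
  exists2 y, F y & f y = z.
Proof.
move=> cF sF fK zF.
suff [y [Fy zy]] : exists y, F y /\ z = f y by exists y.
apply: (@closed_bounded_dom R Y X [set p | F p.2 /\ p.1 = f p.2] K z).
- move=> [a b] /closureP_nrm2 Gab; split => /=.
    by apply/cF/closureP_nrm => e /Gab[x' [y' [[/= Fy' _] _ lt]]]; exists y'.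
  have [M M0 MP] := adj_bounded.
  apply/subr0_eq/nrm_eq0/le_anti; rewrite nrm_ge0 andbT.
  apply/ler_addgt0Pr => e e0; rewrite add0r.
  have [|x' [y' [[/= _ x'E] ax byy]]] := Gab (e / (M + 1)).
    by rewrite divr_gt0// ltr_wpDl// ltW.
  rewrite (le_trans (nrm_tri x' _ _))// x'E -adjB nrmBC.
  have := MP (y' - b); rewrite [nrm (y' - b)]nrmBC.
  move: ax byy; rewrite x'E nrmBC !ltr_pdivlMr ?ltr_wpDl ?(ltW M0)//.
  by have := nrm_ge0 (b - y'); have := nrm_ge0 (f y' - a); nra.
- by move=> a b a' b' [/= Fb ->] [/= Fb' ->]; rewrite -adjB; apply: fK; exact: submoduleB.
- by move=> e /zF[y Fy zy]; exists (f y), y.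
Qed.

End Adj.

Lemma perturbation_surjective X (T T' L D : X -> X) (K d K' : R) :
  adj T T' -> (forall y, T y = L y + D y) ->
  (forall z, exists2 y, L y = z & nrm y <= K * nrm z) ->
  (forall y, nrm (D y) <= d * nrm y) ->
  0 <= K -> 0 <= d -> d * K < 1 ->
  (forall y, nrm y <= K' * nrm (T y)) ->
  forall z, exists y, T y = z.
Proof.
move=> TT' TE LK Dd K0 d0 dK TK z.
have dK0 : 0 <= d * K by rewrite mulr_ge0.
have approx n : exists y, nrm (z - T y) <= nrm z * (d * K) ^+ n.
  elim: n => [|n [y IH]]; first by exists 0; rewrite (adj0 TT') subr0 expr0 mulr1.
  have [y' Ly' y'K] := LK (z - T y); exists (y + y').
  rewrite (adjD TT') opprD addrA (TE y') Ly' opprD addNKr nrmN.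
  rewrite (le_trans (Dd _))// exprS mulrCA -!mulrA ler_wpM2l// (le_trans y'K)//.
  by rewrite ler_wpM2l.
have [||y _ ?] := @adj_surjective_of_lower _ _ T T' TT' setT K' z closedT (submoduleT _).
- by move=> y _; exact: TK.
- move=> e e0; have [|n ne] := @expr_small R (d * K) (nrm z) e _ e0.
    by rewrite dK0.
  by have [y yn] := approx n; exists y => //; exact: le_lt_trans ne.
- by exists y.
Qed.

Lemma conjC_ireal (m : R) : ('i * m%:C%C : R[i])^* = - ('i * m%:C%C).
Proof.
rewrite rmorphM/= conjCi mulNr; congr (- (_ * _)).
exact: (conjc_real m).
Qed.

Lemma nrmZir X (m : R) (x : X) : nrm (('i * m%:C%C) *: x) = `|m| * nrm x.
Proof. by rewrite -scalerA nrmZi nrmZr. Qed.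

(** * Symmetric maps shifted by imaginary scalars *)

Section Symmetric.
Variables (X : hilbertModType A) (S : X -> X).
Hypothesis SS : adj S S.

Lemma symmetric_lower (m : R) x : `|m| * nrm x <= nrm (S x - ('i * m%:C%C) *: x).
Proof.
set N := nrm (S x - _); set a := nrm x; set b := nrm (S x).
have a0 : 0 <= a := nrm_ge0 _; have N0 : 0 <= N := nrm_ge0 _.
have [s [s2 sm]] : exists s : R, s * s = 1 /\ s * m = `|m|.
  have [m0|m0] := leP 0 m; first by exists 1; rewrite !mul1r ger0_norm.
  by exists (-1); rewrite ltr0_norm//; split; ring.
(* [1 + i e S] expands norms only by a factor [1 + O(e^2)]. *)
have expand (e : R) : nrm (x + ('i * e%:C%C) *: S x) ^+ 2 <= a ^+ 2 + e ^+ 2 * b ^+ 2.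
  rewrite -nrm_inner innerDl !innerDr !innerZl !innerZr conjC_ireal SS.
  rewrite scalerA mulNr -expr2 exprMn sqrCi mulN1r opprK scaleNr.
  rewrite addrA addrK (le_trans (nrmD _ _))//.
  by rewrite -rmorphXn/= nrmZr !nrm_inner ger0_norm ?sqr_ge0.
(* With [s] the sign of [m], [(1 + e |m|) x] is [x - i e s S x] plus [i e s (S x - i m x)]: a
   violation of the bound would be a gain of first order in [e], against the second-order bound
   [expand]. *)
have key (e : R) : 0 < e ->
    a + e * (`|m| * a) <= e * N + nrm (x + ('i * (- e * s)%:C%C) *: S x).
  move=> e0; set P := nrm (x + _).
  have E : (1 + e * `|m|)%:C%C *: x = (x + ('i * (- e * s)%:C%C) *: S x)
      - ('i * (- e * s)%:C%C) *: (S x - ('i * m%:C%C) *: x).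
    rewrite scalerBr opprB addrCA addrK scalerA mulrACA -expr2 sqrCi mulN1r.
    rewrite -rmorphM/= -mulrA sm mulNr rmorphN opprK rmorphD/= scalerDl.
    by rewrite scale1r addrC.
  have := nrmB (x + ('i * (- e * s)%:C%C) *: S x)
    (('i * (- e * s)%:C%C) *: (S x - ('i * m%:C%C) *: x)).
  rewrite -E nrmZr nrmZir -/N -/P -/a ger0_norm; last first.
    by rewrite addr_ge0// mulr_ge0// ltW.
  have -> : `|- e * s| = e.
    apply/eqP; rewrite -(eqrXn2 (ltn0Sn 1)) ?(ltW e0)// -normrX exprMn sqrrN.
    by rewrite [s ^+ 2]expr2 s2 mulr1 ger0_norm// sqr_ge0.
  by rewrite mulrDl mul1r; lra.
rewrite leNgt; apply/negP => lt.
pose d : R := `|m| * a - N; have d0 : 0 < d by rewrite subr_gt0.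
have {}a0 : 0 < a.
  rewrite lt0r a0 andbT; apply/negP => /eqP aE.
  by move: lt; rewrite aE mulr0; lra.
(* Chosen so that the first-order gain [2 e a d = 2 e^2 (b^2 + 1)] exceeds [e^2 b^2]. *)
pose e := a * d / (b ^+ 2 + 1).
have b1 : 0 < b ^+ 2 + 1 by rewrite ltr_wpDl ?sqr_ge0.
have e0 : 0 < e by rewrite divr_gt0// mulr_gt0.
have eE : e * (b ^+ 2 + 1) = a * d by rewrite /e divfK// gt_eqF.
have := key e e0; have := expand (- e * s).
rewrite exprMn sqrrN [s ^+ 2]expr2 s2 mulr1.
set P := nrm _ => P2 Pk.
have aP : a + e * d <= P by rewrite /d; lra.
have : (a + e * d) ^+ 2 <= a ^+ 2 + e ^+ 2 * b ^+ 2.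
  apply: le_trans P2; rewrite ler_sqr ?nnegrE ?nrm_ge0//.
  exact: addr_ge0 (ltW a0) (mulr_ge0 (ltW e0) (ltW d0)).
have : e * (a * d) = e ^+ 2 * b ^+ 2 + e ^+ 2 by rewrite -eE; ring.
have : 0 < e * (a * d) := mulr_gt0 e0 (mulr_gt0 a0 d0).
have := sqr_ge0 (e * d).
have : 0 < e ^+ 2 := exprn_gt0 2 e0.
by rewrite exprMn; lra.
Qed.

Lemma adj_shift (m : R) :
  adj (fun x => S x - ('i * m%:C%C) *: x) (fun x => S x + ('i * m%:C%C) *: x).
Proof.
move=> x y; rewrite innerBl innerDr innerZl innerZr SS conjC_ireal.
by rewrite scaleNr opprK.
Qed.

(** Two perturbations: [S] is added to the scalar [- i n] with [|n|] large, then [n] is moved to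
    [m], the inverse of [S - i n] being bounded by [1 / |n|]. *)
Lemma symmetric_surjective (m : R) : m != 0 ->
  forall z, exists x, S x - ('i * m%:C%C) *: x = z.
Proof.
move=> m0; have [M M0 SM] := adj_bounded SS.
have lower (n : R) : n != 0 ->
    forall y, nrm y <= `|n|^-1 * nrm (S y - ('i * n%:C%C) *: y).
  by move=> n0 y; rewrite ler_pdivlMl ?normr_gt0// symmetric_lower.
have i0 (n : R) : n != 0 -> 'i * n%:C%C != 0 :> R[i].
  move=> n0; rewrite mulf_neq0 ?neq0Ci//.
  by apply: contra_neq n0 => nC; exact: (@complexI R n 0 nC).
have m1 : 0 < `|m| by rewrite normr_gt0.
(* Then [|n| = |m| + M] and [|n - m| = M], so the single inequality [M / |n| < 1] serves both
   perturbations. *)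
pose n := m * (1 + M / `|m|).
have nE : `|n| = `|m| + M.
  rewrite normrM [X in _ * X]ger0_norm; last by rewrite addr_ge0// divr_ge0// ltW.
  by rewrite mulrDr mulr1 mulrCA divff ?mulr1// gt_eqF.
have n0 : n != 0 by rewrite -normr_gt0 nE addr_gt0.
have mn : `|n - m| = M.
  rewrite /n mulrDr mulr1 addrC addKr normrM [X in _ * X]ger0_norm.
    by rewrite mulrCA divff ?mulr1// gt_eqF.
  by rewrite divr_ge0// ltW.
have lt1 : M * `|n|^-1 < 1 by rewrite ltr_pdivrMr nE ?mul1r; lra.
have surjn : forall z, exists y, S y - ('i * n%:C%C) *: y = z.
  apply: (perturbation_surjective (L := fun y => - (('i * n%:C%C) *: y)) (D := S)
    (adj_shift n) _ _ SM _ _ lt1 (lower n n0)) => [y|z||].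
  - by rewrite addrC.
  - exists (- (('i * n%:C%C)^-1 *: z)).
      by rewrite scalerN opprK scalerA divff ?scale1r// i0.
    rewrite nrmN ler_pdivlMl ?normr_gt0// -nrmZir scalerA.
    by rewrite divff ?scale1r ?i0.
  - by rewrite invr_ge0.
  - exact: ltW.
apply: (perturbation_surjective (L := fun y => S y - ('i * n%:C%C) *: y)
    (D := fun y => ('i * (n - m)%:C%C) *: y)
    (adj_shift m) _ _ _ _ _ lt1 (lower m m0)) => [y|z|y||].
- by rewrite rmorphB/= mulrBr scalerBl addrA addrNK.
- by have [y yz] := surjn z; exists y => //; rewrite -yz lower.
- by rewrite nrmZir mn.
- by rewrite invr_ge0.
- exact: ltW.
Qed.

End Symmetric.

End Adjoints.

(** * Inverting [f g] on the closed range of [f] *)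

Section ClosedRange.
Context {R : realType} {A : cstarAlgType R}.
Implicit Types X Y Z : hilbertModType A.

(** On [range f] the pairing [<y, f x> = <g y, x>] is controlled by [|g y|], so uniform boundedness
    gives [|y| <= K |g y|]. Then [|g y|^2 = |<y, f (g y)>| <= 8 K |g y| |f (g y)|]. *)
Lemma adj_closed_range_lower X Y (f : X -> Y) (g : Y -> X) :
  adj f g -> closed (range f) ->
  exists2 K : R, 0 < K & forall y, range f y -> nrm y <= K * nrm (f (g y)).
Proof.
move=> fg cF; have sF := adj_submodule_range fg; have [_ _ FZ] := sF.
have [l x y [/= Fy ->]|x y []//|_ [x _ <-]|K K0 KP] :=
  @bounded_relation _ _ X Y (range f) [set p | range f p.2 /\ p.1 = g p.2] cF sF.
- by split=> /=; [exact: FZ|rewrite (adjZ (adj_sym fg))].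
- exists (8 * nrm x) => _ y [/= _ ->]; rewrite -(adj_sym fg).
  by rewrite (le_trans (nrm_inner_le _ _))// mulrA mulrAC.
exists (K * (8 * K)) => [|y Fy]; first by rewrite !mulr_gt0.
have yK : nrm y <= K * nrm (g y) by exact: KP.
have gy0 := nrm_ge0 (g y); have S0 := nrm_ge0 (f (g y)).
rewrite (le_trans yK)// -mulrA ler_wpM2l ?(ltW K0)//.
have := nrm_inner_le y (f (g y)); rewrite -(adj_sym fg) nrm_inner => gS.
have {}gS : nrm (g y) ^+ 2 <= 8 * (K * nrm (g y) * nrm (f (g y))).
  by rewrite (le_trans gS)// ler_wpM2l// ler_wpM2r.
have [->|g0] := eqVneq (nrm (g y)) 0; first by rewrite !mulr_ge0// ltW.
have {}gy0 : 0 < nrm (g y) by rewrite lt0r g0.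
by rewrite -(ler_pM2l gy0) -expr2 (le_trans gS)// le_eqVlt; apply/orP; left; apply/eqP; ring.
Qed.

Lemma adj_closed_range_surjective X Y (f : X -> Y) (g : Y -> X) :
  adj f g -> closed (range f) ->
  forall z, range f z -> exists2 y, range f y & f (g y) = z.
Proof.
move=> fg cF z Fz; have sF := adj_submodule_range fg; have [_ FD FZ] := sF.
have SS := adj_comp_sym fg.
have [K K0 KP] := adj_closed_range_lower fg cF.
apply: (adj_surjective_of_lower SS cF sF KP) => e e0.
pose c := 2 * K * nrm z; have c0 : 0 <= c by rewrite !mulr_ge0 ?nrm_ge0// ltW.
(* The first bound lets [|y| <= K (|z| + m |y|)] be absorbed into [|y| <= c]; the second makes the
   error [m |y|] less than [e]. *)
pose m := Num.min (2 * K)^-1 (e / (c + 1)).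
have m0 : 0 < m by rewrite lt_min invr_gt0 mulr_gt0// divr_gt0// ltr_wpDl.
have Km : 2 * K * m <= 1.
  by rewrite -ler_pdivlMl ?mulr_gt0// mulr1 ge_min lexx.
have me : m * (c + 1) <= e by rewrite -ler_pdivlMr ?ltr_wpDl// ge_min lexx orbT.
have [y /= yz] := symmetric_surjective SS (lt0r_neq0 m0) z.
have Fy : range f y.
  have -> : y = ('i * m%:C%C)^-1 *: (f (g y) - z).
    rewrite -yz opprB addrCA subrr addr0 scalerA mulVf ?scale1r//.
    rewrite mulf_neq0 ?neq0Ci//.
    by apply: contra_neq (lt0r_neq0 m0) => mC; exact: (@complexI R m 0 mC).
  by apply: FZ; apply: submoduleB => //; exists (g y).
exists y => //=.
have zy : nrm (z - f (g y)) = m * nrm y.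
  by rewrite -yz addrAC subrr add0r nrmN nrmZir gtr0_norm.
rewrite zy; have := KP _ Fy; have := nrm_le (f (g y)) z.
rewrite nrmBC zy => zS yS.
have : nrm y <= c.
  have : K * nrm (f (g y)) <= K * (nrm z + m * nrm y) by rewrite ler_wpM2l// ltW.
  have : 2 * K * m * nrm y <= 1 * nrm y by rewrite ler_wpM2r ?nrm_ge0.
  by rewrite /c; lra.
move=> yc; have : m * nrm y <= m * c by rewrite ler_wpM2l// ltW.
by lra.
Qed.

(* [W] is the Moore-Penrose inverse of [f g]; all the others are expressed
   through it. *)
Lemma adj_closed_range_pinv X Y (f : X -> Y) (g : Y -> X) :
  adj f g -> closed (range f) -> exists W : Y -> Y,
  [/\ adj W W,
      forall y, f (g (W (f (g y)))) = f (g y),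
      forall y, W (f (g (W y))) = W y &
      forall y, f (g (W y)) = W (f (g y))].
Proof.
move=> fg cF; have sF := adj_submodule_range fg.
have SS := adj_comp_sym fg; set S := f \o g in SS.
have FS y : range f (S y) by exists (g y).
have [K K0 KP] := adj_closed_range_lower fg cF.
have Sinj y z : range f y -> range f z -> S y = S z -> y = z.
  move=> Fy Fz yz; apply/subr0_eq/nrm_eq0/le_anti; rewrite nrm_ge0 andbT.
  rewrite (le_trans (KP _ (submoduleB sF Fy Fz)))// -[f _]/(S (y - z)).
  by rewrite (adjB SS) yz subrr nrm0 mulr0.
have surj := adj_closed_range_surjective fg cF.
(* [S (S w) = S y] says that [S w] is the component of [y] in [range f], so [w] inverts [S] there
   without a projection being constructed. *)
have /choice[W WP] y : exists w, range f w /\ S (S w) = S y.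
  have [v Fv vy] := surj _ (FS y); have [w Fw wv] := surj _ Fv.
  by exists w; split => //; rewrite -[S w]/(f (g w)) wv.
have WF y := (WP y).1; have SSW y := (WP y).2.
have SWS y : S (W (S y)) = S y by apply: Sinj => //; rewrite SSW.
have SW y : S (W y) = W (S y) by apply: Sinj => //; rewrite SSW SWS.
have WSW y : W (S (W y)) = W y by apply: Sinj => //; rewrite SWS.
have WE y : W y = S (W (W y)) by rewrite SW WSW.
exists W; split=> // y z.
have -> : inner (W y) z = inner (W y) (S (W z)).
  by rewrite {1}WE SS -SSW -SS -WE.
by rewrite [in RHS]WE -[RHS]SS -(SSW y) [RHS]SS -WE SS.
Qed.

End ClosedRange.

(** * Graphs of everywhere defined maps and their regularity *)

Section Graphs.
Context {R : realType} {A : cstarAlgType R}.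
Implicit Types X Y Z : hilbertModType A.

Definition graph X Y (f : X -> Y) : set (X * Y) := [set p | p.2 = f p.1].
Arguments graph X Y f p /.

Lemma eq_graph X Y (f f' : X -> Y) : f =1 f' -> graph f = graph f'.
Proof. by move=> /funext ->. Qed.

Lemma opcomp_graph X Y Z (f : X -> Y) (g : Y -> Z) :
  opcomp (graph g) (graph f) = graph (g \o f).
Proof.
apply/seteqP; split=> -[x z] /=; first by move=> [y]; rewrite /graph /= => -> ->.
by move=> ->; exists (f x).
Qed.

Lemma opadd_id_graph X (f : X -> X) :
  opadd (@opid R A X) (graph f) = graph (fun x => x + f x).
Proof.
apply/seteqP; split=> -[x y] /=; first by move=> [a [b []]]; rewrite /opid /graph /= => -> -> ->.
by move=> ->; exists x, (f x).
Qed.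

Lemma dom_graph X Y (f : X -> Y) : dom (graph f) = setT.
Proof. by apply/seteqP; split=> // x _; exists (f x). Qed.

Lemma ran_graph X Y (f : X -> Y) : ran (graph f) = range f.
Proof. by apply/seteqP; split=> y [x]; [move=> /= ->; exists x|move=> _ <-; exists x]. Qed.

Lemma total_operator_graph X Y (t : set (X * Y)) :
  (forall x y1 y2, t (x, y1) -> t (x, y2) -> y1 = y2) ->
  (forall x, exists y, t (x, y)) -> exists f, t = graph f.
Proof.
move=> tU /choice[f tf]; exists f; apply/seteqP; split=> -[x y] /=.
  by move=> txy; exact: tU txy (tf x).
by move=> ->; exact: tf.
Qed.

Lemma adjoint_closed X Y (t : set (X * Y)) : closed (adjoint t).
Proof.
move=> [y x] /closureP_nrm2 yx a b tab /=.
apply/subr0_eq/nrm_eq0/le_anti; rewrite nrm_ge0 andbT.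
pose C := 8 * (nrm a + nrm b) + 1.
have C0 : 0 < C by rewrite ltr_wpDl// mulr_ge0// addr_ge0 ?nrm_ge0.
apply/ler_addgt0Pr => e e0; rewrite add0r.
have [y' [x' [yx' ye xe]]] := yx (e / C) (divr_gt0 e0 C0).
rewrite (le_trans (nrm_tri (inner b y') _ _))// {2}(yx' _ _ tab) -!innerBr.
have eE : e / C * C = e by rewrite divfK// gt_eqF.
have ec0 : 0 < e / C by rewrite divr_gt0.
have := nrm_inner_le b (y - y'); have := nrm_inner_le a (x' - x).
rewrite [nrm (x' - x)]nrmBC.
have : nrm b * nrm (y - y') <= nrm b * (e / C) by rewrite ler_wpM2l ?nrm_ge0// ltW.
have : nrm a * nrm (x - x') <= nrm a * (e / C) by rewrite ler_wpM2l ?nrm_ge0// ltW.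
by move: eE; rewrite {2}/C; nra.
Qed.

Lemma adjoint_graph X Y (f : X -> Y) (g : Y -> X) :
  adj f g -> adjoint (graph f) = graph g.
Proof.
move=> fg; apply/seteqP; split=> -[y x] /=; last by move=> -> a _ /= ->; exact: fg.
by move=> yx; apply: inner_ext => a; rewrite -fg; apply/esym/yx.
Qed.

Lemma closed_graph X Y (f : X -> Y) (g : Y -> X) : adj f g -> closed (graph f).
Proof. by move=> /adj_sym/adjoint_graph <-; exact: adjoint_closed. Qed.

Lemma denseT (V : normedModType R[i]) : dense [set: V].
Proof. by move=> O [x Ox] _; exists x. Qed.

Lemma regular_graph X Y (f : X -> Y) (g : Y -> X) : adj f g ->
  dense (range (fun x => x + g (f x))) -> regular (graph f).
Proof.
move=> fg d; rewrite /regular /adjointable /densely_defined (adjoint_graph fg).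
rewrite opcomp_graph opadd_id_graph ran_graph !dom_graph.
split=> //; [|exact: denseT|exact: closed_graph fg|by split; exact: denseT].
split=> [x _ _ /= -> ->//||x1 x2 _ _ /= -> ->|l x _ /= ->|a x _ /= ->] /=.
- by rewrite (adj0 fg).
- by rewrite (adjD fg).
- by rewrite (adjZ fg).
- by rewrite (adj_ract fg).
Qed.

(** * Moore-Penrose inverses of everywhere defined maps *)

Section MoorePenrose.
Variables (X Y : hilbertModType A) (f : X -> Y) (g : Y -> X).
Variables (h : Y -> X) (k : X -> Y).
Hypotheses (fg : adj f g) (hk : adj h k).
Hypotheses (fhf : forall x, f (h (f x)) = f x) (hfh : forall y, h (f (h y)) = h y).
Hypotheses (fh_sym : adj (f \o h) (f \o h)) (hf_sym : adj (h \o f) (h \o f)).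

Lemma moore_penrose_graph : dense (range (fun y => y + k (h y))) ->
  moore_penrose (graph f) (graph h).
Proof.
move=> d; split; first exact: regular_graph hk d.
- by rewrite !opcomp_graph; exact: eq_graph.
- by rewrite !opcomp_graph; exact: eq_graph.
- by rewrite opcomp_graph (adjoint_graph fh_sym); apply/closure_id; exact: closed_graph fh_sym.
- by rewrite opcomp_graph (adjoint_graph hf_sym); apply/closure_id; exact: closed_graph hf_sym.
Qed.

(** The algebraic uniqueness argument, run on pairs of [s] because [s] may be partial: the symmetry
    of [ts] gives [f (h y) = f x], then that of [st] gives [x = h (f x)]. *)
Lemma moore_penrose_graph_sub (s : set (Y * X)) :
  moore_penrose (graph f) s -> s `<=` graph h.
Proof.
move=> [[[sU s0 sD sZ _] _ _ _ _] tst sts ts_sym st_sym] [y x] sx.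
have fs a : exists a', s (f a, a') /\ f a' = f a.
  have : graph f (a, f a) by [].
  by rewrite -tst => -[a' [_ /= -> sa] /= fa]; exists a'.
have sfx : s (f x, x).
  have [b [c /= scx fcb]] : opcomp s (opcomp (graph f) s) (y, x) by rewrite sts.
  by rewrite fcb -(sU _ _ _ sx scx).
have ts y1 x1 y2 x2 : s (y1, x1) -> s (y2, x2) -> inner (f x1) y2 = inner y1 (f x2).
  move=> s1 s2; have : adjoint (opcomp (graph f) s) (y2, f x2).
    by rewrite ts_sym; apply: subset_closure; exists x2.
  by apply; exists x1 => /=.
have st a a' b b' : s (f a, a') -> s (f b, b') -> inner a' b = inner a b'.
  move=> s1 s2; have : adjoint (opcomp s (graph f)) (b, b').
    by rewrite st_sym; apply: subset_closure; exists (f b).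
  by apply; exists (f a) => /=.
have fhy : f (h y) = f x.
  rewrite -[RHS]fhf; apply/subr0_eq; rewrite -(adjB fh_sym).
  (* Since [s] kills [y - f x], symmetry of [ts] makes this vector orthogonal to [range f]. *)
  have sy0 : s (y - f x, 0).
    by have := sD _ _ _ _ sx (sZ (-1) _ _ sfx); rewrite !scaleN1r subrr.
  apply: inner_extl => z; rewrite fh_sym inner0l /=.
  have [z' [sz' <-]] := fs (h z).
  by rewrite -(ts _ _ _ _ sy0 sz') (adj0 fg) inner0l.
rewrite /= -hfh fhy; apply: inner_extl => z.
have [z' [sz' _]] := fs z.
have -> : inner x z = inner x z' by exact: st sz'.
rewrite -[h (f x)]/((h \o f) x) hf_sym; apply/esym.
by apply: st sfx _ => /=; rewrite fhf.
Qed.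

(* A regular [s] contained in the bounded, everywhere defined [h] equals it,
   being closed and densely defined. *)
Lemma moore_penrose_graph_unique (s : set (Y * X)) :
  moore_penrose (graph f) s -> s = graph h.
Proof.
move=> mp; have sh := moore_penrose_graph_sub mp.
case: mp => -[_ ds cs _ _] _ _ _ _; apply/seteqP; split=> //.
have [K K0 hK] := adj_bounded hk.
move=> [y x] /= ->; have [|e e0|x' sx'] := @closed_bounded_dom R _ _ s K y cs.
- by move=> a b a' b' /sh/= -> /sh/= ->; rewrite -(adjB hk).
- have [a [b sab] ya] := (denseP_nrm _).1 ds y e e0.
  by exists a, b.
by have /= <- := sh _ sx'.
Qed.

Lemma mpinv_graph : dense (range (fun y => y + k (h y))) -> mpinv (graph f) = graph h.
Proof.
move=> d; apply: xget_unique; first exact: moore_penrose_graph.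
exact: moore_penrose_graph_unique.
Qed.

End MoorePenrose.

(** Approximate form of [(1 + ba)^-1 = 1 - b (1 + ab)^-1 a]. *)
Lemma dense_range_swap X Y (a : Y -> X) a' (b : X -> Y) b' : adj a a' -> adj b b' ->
  dense (range (fun x => x + a (b x))) -> dense (range (fun y => y + b (a y))).
Proof.
move=> aa' bb' /denseP_nrm d; apply/denseP_nrm => y e e0.
have [K K0 bK] := adj_bounded bb'.
have [_ [u _ <-] ue] := d (a y) (e / K) (divr_gt0 e0 K0).
exists ((y - b u) + b (a (y - b u))); first by exists (y - b u).
have -> : y - (y - b u + b (a (y - b u))) = - b (a y - (u + a (b u))).
  by rewrite (adjB aa') !(adjB bb') (adjD bb') !opprD !opprK addrA addNKr addrCA.
by rewrite nrmN (le_lt_trans (bK _))// mulrC -ltr_pdivlMr.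
Qed.

(** With the projection [P = W S], the approximate inverse of [1 + W] is [P (1 + S)^-1 S + (1 - P)]:
    off the range of [P], [1 + W] is the identity. *)
Lemma dense_range_pinv Y (S W : Y -> Y) : adj W W ->
  (forall y, W (S (W y)) = W y) -> (forall y, S (W y) = W (S y)) ->
  dense (range (fun y => y + S y)) -> dense (range (fun y => y + W y)).
Proof.
move=> WW WSW SW /denseP_nrm d; apply/denseP_nrm => y e e0.
have [K K0 WK] := adj_bounded WW.
have [_ [u _ <-] ue] := d (S y) (e / K) (divr_gt0 e0 K0).
pose a := W (S u) + (y - W (S y)).
exists (a + W a); first by exists a.
have -> : y - (a + W a) = W (S y - (u + S u)).
  have -> : W a = W u.
    by rewrite (adjD WW) (adjB WW) -(SW u) WSW -(SW y) WSW subrr addr0.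
  rewrite /a (adjB WW) (adjD WW) !opprD opprK.
  by rewrite -!addrA [- W (S u) + _]addrCA addNKr addrCA [- W (S u) + _]addrC.
by rewrite (le_lt_trans (WK _))// mulrC -ltr_pdivlMr.
Qed.

Lemma dense_range_sqr Y (S : Y -> Y) : adj S S -> dense (range (fun y => y + S (S y))).
Proof.
move=> SS; suff -> : range (fun y => y + S (S y)) = setT by exact: denseT.
apply/seteqP; split=> // z _.
have [u uz] := symmetric_surjective SS (oner_neq0 R) z.
have N1 : -1 != 0 :> R by rewrite oppr_eq0 oner_neq0.
have [y yu] := symmetric_surjective SS N1 u.
exists y => //; rewrite -uz -yu (adjB SS) (adjZ SS) rmorphN mulrN !scaleNr !opprK.
rewrite mulr1 scalerDr scalerA -expr2 sqrCi scaleN1r opprD opprK.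
by rewrite addrA addrK addrC.
Qed.

End Graphs.

(** * Reduction to an adjoint pair of everywhere defined maps *)

Section Bounded.
Context {R : realType} {A : cstarAlgType R}.
Variables (X Y : hilbertModType A) (t : set (X * Y)).
Hypothesis t_regular : regular t.

(* For [x] in the domain, [|t x|] is controlled through [inner (t x) y], which is
   bounded in [x] as soon as [y] lies in the domain of the adjoint. *)
Lemma regular_bounded : closed (ran t) -> ran t `<=` dom (adjoint t) ->
  exists f g, [/\ adj f g, t = graph f & adjoint t = graph g].
Proof.
case: t_regular => -[tU t0 tD tZ _] dt ct [_ dt'] _ cF Fdom.
have tB x1 y1 x2 y2 : t (x1, y1) -> t (x2, y2) -> t (x1 - x2, y1 - y2).
  by move=> t1 t2; have := tD _ _ _ _ t1 (tZ (-1) _ _ t2); rewrite !scaleN1r.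
have sF : submodule (ran t).
  split=> [|y1 y2 [x1 t1] [x2 t2]|l y [x txy]]; first by exists 0.
    by exists (x1 + x2); exact: tD.
  by exists (l *: x); exact: tZ.
have [x y txy|z /Fdom[w zw]|K K0 tK] := bounded_relation cF sF tZ.
- by exists x.
- exists (8 * nrm w) => x y txy; rewrite (zw _ _ txy) /=.
  by rewrite (le_trans (nrm_inner_le _ _))// mulrA mulrAC.
have [|f tE] := total_operator_graph tU.
  move=> x; apply: (closed_bounded_dom (K := K) ct) => [a b a' b' tab tab'|e e0].
    by apply: tK; exact: tB.
  have [a [b tab] xa] := (denseP_nrm _).1 dt x e e0.
  by exists a, b.
have fK x : nrm (f x) <= K * nrm x by apply: tK; rewrite tE.
have aU y z1 z2 : adjoint t (y, z1) -> adjoint t (y, z2) -> z1 = z2.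
  rewrite tE => y1 y2; apply: inner_ext => x.
  by rewrite -(y1 x (f x))// -(y2 x (f x)).
have [|g gE] := total_operator_graph aU.
  move=> y; apply: (closed_bounded_dom (K := 8 * K) (@adjoint_closed _ _ _ _ t)).
    move=> a b a' b' ab ab'; set z := b - b'.
    (* Since [f] is total, a difference [z] of adjoint values can itself be tested, giving
       [|z|^2 <= 8 K |z| |a - a'|]. *)
    have zz : inner z z = inner (f z) (a - a').
      have tz : t (z, f z) by rewrite tE.
      by rewrite {2}/z !innerBr (ab _ _ tz) (ab' _ _ tz).
    have [z0|z0] := eqVneq (nrm z) 0.
      by rewrite z0 !mulr_ge0 ?nrm_ge0// ltW.
    have {}z0 : 0 < nrm z by rewrite lt0r z0 nrm_ge0.
    rewrite -(ler_pM2l z0) -expr2 -nrm_inner zz (le_trans (nrm_inner_le _ _))//.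
    rewrite [leRHS](_ : _ = 8 * (K * nrm z * nrm (a - a'))); last by ring.
    by rewrite ler_wpM2l// ler_wpM2r ?nrm_ge0.
  move=> e e0; have [a [b ab] ya] := (denseP_nrm _).1 dt' y e e0.
  by exists a, b.
exists f, g; split=> // x y.
have : adjoint t (y, g y) by rewrite gE.
by apply; rewrite tE.
Qed.

End Bounded.

Theorem corollary2p3 (R : realType) (A : cstarAlgType R)
    (X Y : hilbertModType A) (t : set (X * Y))
    (t_regular : regular t) (t_closed_range : closed (ran t))
    (ran_dom : ran t `<=` dom (adjoint t)) :
  (mpinv t = opcomp (mpinv (opcomp (adjoint t) t)) (adjoint t) /\
   mpinv t = opcomp (adjoint t) (mpinv (opcomp t (adjoint t)))) /\
  mpinv (opcomp (adjoint t) t) = opcomp (mpinv t) (mpinv (adjoint t)).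
Proof.
have [f [g [fg tE gE]]] := regular_bounded t_regular t_closed_range ran_dom.
have dgf : dense (range (fun x => x + g (f x))).
  by case: t_regular => _ _ _ _; rewrite gE tE opcomp_graph opadd_id_graph ran_graph.
move: t_closed_range; rewrite gE {}tE {t_regular ran_dom gE} ran_graph => cF.
have [W [WW SWS WSW SW]] := adj_closed_range_pinv fg cF.
have gf := adj_sym fg.
(* For [u = W S y - y] one has [S u = 0], hence [<g u, g u> = <u, S u> = 0]. *)
have gWS y : g (W (f (g y))) = g y.
  apply/subr0_eq; rewrite -(adjB gf); apply: inner_eq0.
  by rewrite gf (adjB gf) (adjB fg) SWS subrr inner0r.
have SWf x : f (g (W (f x))) = f x.
  by apply: inner_extl => y; rewrite fg gf WW fg gWS -fg.
have SWsym : adj (f \o g \o W) (f \o g \o W).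
  have -> : f \o g \o W = W \o (f \o g) by apply/funext => y /=.
  have {2}-> : W \o (f \o g) = f \o g \o W by apply/funext => y /=.
  exact: adj_comp (adj_comp_sym fg) WW.
have gWf : adj (g \o W) (W \o f) := adj_comp WW gf.
have Wfg : adj (W \o f) (g \o W) := adj_sym gWf.
have Wf_sym : adj (g \o W \o f) (g \o W \o f) := adj_comp fg gWf.
have gWWf : adj (g \o W \o (W \o f)) (g \o W \o (W \o f)) := adj_comp Wfg gWf.
(* Regularity of [g W] asks for [1 + (W f)(g W) = 1 + W]; density passes from [1 + g f] to [1 + f g]
   and then to [1 + W]. *)
have d1W : dense (range (fun y => y + W y)).
  by apply: (dense_range_pinv WW WSW SW); exact: dense_range_swap gf fg dgf.
have WfgW : (fun y => y + (W \o f) ((g \o W) y)) = (fun y => y + W y).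
  by apply/funext => y /=; rewrite WSW.
have tP : mpinv (graph f) = graph (g \o W).
  apply: (mpinv_graph fg gWf) => [x|y|//|//|].
  - exact: SWf.
  - by rewrite /= WSW.
  - by rewrite WfgW.
have taP : mpinv (graph g) = graph (W \o f).
  apply: (mpinv_graph gf Wfg) => [y|x|||].
  - exact: gWS.
  - by rewrite /= WSW.
  - have -> : g \o (W \o f) = g \o W \o f by [].
    exact: Wf_sym.
  - have -> : (W \o f) \o g = f \o g \o W by apply/funext => y /=.
    exact: SWsym.
  - by apply: (dense_range_swap Wfg gWf); rewrite WfgW.
have ttaP : mpinv (graph (f \o g)) = graph W.
  apply: (mpinv_graph (adj_comp_sym fg) WW) => //=; last exact: dense_range_sqr.
  have -> : W \o (f \o g) = f \o g \o W by apply/funext => y /=.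
  exact: SWsym.
have tatP : mpinv (graph (g \o f)) = graph (g \o W \o (W \o f)).
  apply: (mpinv_graph (adj_comp_sym gf) gWWf) => [x|x|||] /=.
  - by rewrite -(SW (f x)) WSW SWf.
  - by rewrite (SW (W (f x))) !WSW.
  - have -> : (g \o f) \o (g \o W \o (W \o f)) = g \o W \o f.
      by apply/funext => x /=; rewrite (SW (W (f x))) WSW.
    exact: Wf_sym.
  - have -> : (g \o W \o (W \o f)) \o (g \o f) = g \o W \o f.
      by apply/funext => x /=; rewrite -(SW (f x)) SWf.
    exact: Wf_sym.
  - exact: dense_range_sqr gWWf.
(* Two of the identities now hold by conversion; there remains [g W = g W W f g]. *)
rewrite !opcomp_graph tP taP ttaP tatP !opcomp_graph; split=> //; split=> //.
by apply: eq_graph => y /=; rewrite -(SW y) WSW.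
Qed.
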